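(* Let $p=1$ and let $(\omega^*,\lambda^* )\in\mathbb{R}^n\times\mathbb{R}^r$ be a local optimum of the problem $$\min_{\omega,\lambda} f(\omega)\quad\text{s.t.}\quad 0\in\partial_\omega\left(G(\omega,\bar\lambda)+\lambda_1R_1(\omega)\right),\quad \lambda\in\Omega_\epsilon ,$$ such that $$\max_{i\in I(\omega^* )}\left|\frac{\partial G}{\partial\omega_i}(\omega^*,\bar\lambda^* )\right|<\lambda_1^*\psi'(0)$$ (understood as vacuous if $I(\omega^* )=\emptyset$). Suppose that a constraint qualification holds at $(\omega^*,\lambda^* )$ for the constraint system (in the variables $(\omega,\lambda)$, with the index set $I(\omega^* )$ fixed) $$\frac{\partial G(\omega,\bar\lambda)}{\partial\omega_j}+\operatorname{sgn}(\omega_j)\lambda_1\psi'(|\omega_j|)=0\ (j\notin I(\omega^* )),\qquad \omega_j=0\ (j\in I(\omega^* )),\qquad \lambda\in\Omega_\epsilon .$$ Then $(\omega^*,\lambda^* )$ is a bilevel KKT (BKKT) point (with $p=1$).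
   Context: **Data.** $n,r\ge1$; $f:\mathbb{R}^n\to\mathbb{R}$ is continuously differentiable; $g,R_2,\dots,R_r:\mathbb{R}^n\to\mathbb{R}$ are twice continuously differentiable; $\epsilon>0$ is a fixed (small) parameter. The function $\psi:[0,\infty)\to\mathbb{R}$ is twice continuously differentiable on $[0,\infty)$ and there are constants $\alpha,\beta>0$ with $0<\psi'(t)\le\alpha$ and $-\beta\le\psi''(t)\le0$ for all $t\ge0$. Set $R_1(\omega)=\sum_{i=1}^n\psi(|\omega_i|^p)$, so $R_1(\omega)=\sum_i\psi(|\omega_i|)$ for $p=1$. For $\lambda=(\lambda_1,\dots,\lambda_r)\in\mathbb{R}^r$ write $\bar\lambda=(\lambda_2,\dots,\lambda_r)$ and $G(\omega,\bar\lambda)=g(\omega)+\sum_{i=2}^r\lambda_iR_i(\omega)$. Let $\Omega_\epsilon=\{\lambda\in\mathbb{R}^r:\lambda_1\ge\epsilon,\ \lambda_i\ge0\ (i\ge2)\}$, $e_1=(1,0,\dots,0)\in\mathbb{R}^r$, $I(\omega)=\{j:\omega_j=0\}$. Inequalities between vectors are componentwise; $\operatorname{sgn}$ is the sign function with $\operatorname{sgn}(0)=0$. **Subdifferential.** For $h:\mathbb{R}^n\to\mathbb{R}$, $v$ is a regular subgradient of $h$ at $\bar x$ ($v\in\hat\partial h(\bar x)$) if $h(x)\ge h(\bar x)+v^T(x-\bar x)+o(\|x-\bar x\|)$; $v$ is a general subgradient ($v\in\partial h(\bar x)$) if there are $x^\nu\to\bar x$ and $v^\nu\in\hat\partial h(x^\nu)$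 with $v^\nu\to v$ (all functions here are continuous). $\partial_\omega$ is the general subdifferential with respect to $\omega$ (for fixed $\lambda$). **Constraint qualification.** A constraint qualification at $(\omega^*,\lambda^* )$ for a system of smooth equality/inequality constraints means a condition on the constraints under which, whenever $(\omega^*,\lambda^* )$ is a local minimizer of $f(\omega)$ subject to that system, there exist Lagrange multipliers with which it satisfies the standard KKT conditions (for example LICQ or MFCQ). Here $\lambda\in\Omega_\epsilon$ is viewed as the inequalities $\lambda-\epsilon e_1\ge0$. **BKKT point.** $(\omega^*,\lambda^* )\in\mathbb{R}^n\times\mathbb{R}^r$ is a BKKT point if there is $(\zeta^*,\eta^* )\in\mathbb{R}^n\times\mathbb{R}^r$ such that, with $\tilde\omega^*=(\omega_i^* )_{i\notin I(\omega^* )}$, $\tilde\zeta^*=(\zeta_i^* )_{i\notin I(\omega^* )}$ and $\nabla_{\tilde\omega}$ denoting differentiation in the coordinates $\omega_i$, $i\notin I(\omega^* )$, - $\nabla_{\tilde\omega}f(\omega^* )+\widetilde H\tilde\zeta^*=0$, where $\widetilde H=\nabla^2_{\tilde\omega\tilde\omega}G(\omega^*,\bar\lambda^* )+\operatorname{diag}\left(\lambda_1^*p(p-1)|\omega_i^*|^{p-2}\psi'(|\omega_i^*|^p)+\lambda_1^*p^2|\omega_i^*|^{2p-2}\psi''(|\omega_i^*|^p)\right)_{i\notin I(\omega^* )}$, - $\frac{\partial G}{\partial\omega_i}(\omega^*,\bar\lambda^* )+p\lambda_1^*\psi'(|\omega_i^*|^p)|\omega_i^*|^{p-1}\operatorname{sgn}(\omega_i^*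 )=0$ for $i\notin I(\omega^* )$, - $\zeta_i^*=0$ for $i\in I(\omega^* )$, - $p\sum_{i\notin I(\omega^* )}\psi'(|\omega_i^*|^p)|\omega_i^*|^{p-1}\operatorname{sgn}(\omega_i^* )\zeta_i^*=\eta_1^*$, - $\nabla_{\tilde\omega}R_j(\omega^* )^T\tilde\zeta^*=\eta_j^*$ for $j=2,\dots,r$, - $\lambda^*-\epsilon e_1\ge0$, $\eta^*\ge0$, $(\lambda^*-\epsilon e_1)^T\eta^*=0$. *)

(* Defs.v *)
From HB Require Import structures.
From mathcomp Require Export all_boot all_order all_algebra.
From mathcomp Require Export all_classical all_reals all_analysis.
Export Order.TTheory GRing.Theory Num.Theory.
Export numFieldNormedType.Exports.

Set Implicit Arguments.
Unset Strict Implicit.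
Unset Printing Implicit Defensive.

Global Open Scope classical_set_scope.
Global Open Scope ring_scope.

Section Smoothness.
Context {R : realType} {V : normedModType R}.
Implicit Types (h : V -> R) (x v : V).

(* Only used for finite-dimensional V, where continuity of every directional
   derivative is continuity of the gradient. *)
Definition contdiff_at h x : Prop :=
  differentiable h x /\ forall v, {for x, continuous (fun y => 'D_v h y)}.

Definition C1 h : Prop := forall x, contdiff_at h x.

Definition C2 h : Prop := C1 h /\ forall v, C1 (fun y => 'D_v h y).

End Smoothness.

(* d is the derivative of u on [0, +oo[, one-sided at 0; the values of u and d
   at negative arguments are irrelevant. *)
Definition is_derivative_halfline {R : realType} (u d : R -> R) : Prop :=
  forall t, 0 <= t ->
    (u s - u t) / (s - t) @[s --> within `[0, +oo[ t^'] --> d t.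

Section Subdifferential.
Context {R : realType} {n : nat}.
Implicit Types (h : 'rV[R]_n.+1 -> R) (x v : 'rV[R]_n.+1).

Definition dotprod (u v : 'rV[R]_n.+1) : R := \sum_i u ord0 i * v ord0 i.

(* h y >= h x + <v, y - x> + o(|y - x|), as the one-sided condition
   liminf (h y - h x - <v, y - x>) / |y - x| >= 0. The library norm on row
   vectors is the sup norm, equivalent to the Euclidean one. *)
Definition regular_subgradient h x v : Prop :=
  forall e : R, 0 < e ->
    \forall y \near x, h x + dotprod v (y - x) - e * `|y - x| <= h y.

(* For continuous h, as here, h (xs k) --> h x need not be required. *)
Definition subdifferential h x : set 'rV[R]_n.+1 :=
  [set v | exists xs vs : nat -> 'rV[R]_n.+1,
    [/\ xs @ \oo --> x, vs @ \oo --> v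
      & forall k, regular_subgradient h (xs k) (vs k)]].

End Subdifferential.

Section NonlinearProgram.
Context {R : realType} {V : normedModType R}.

Definition local_minimizer (F : V -> R) (A : set V) (z : V) : Prop :=
  A z /\ \forall y \near z, A y -> F z <= F y.

(* eq_con i z = 0 for all i, ineq_con j z >= 0 for all j. *)
Record constraint_system := ConstraintSystem {
  n_eq : nat;
  eq_con : 'I_n_eq -> V -> R;
  n_ineq : nat;
  ineq_con : 'I_n_ineq -> V -> R }.

Implicit Types (S : constraint_system) (F : V -> R) (z : V).

Definition feasible S : set V :=
  [set z | (forall i : 'I_(n_eq S), eq_con i z = 0) /\
           (forall j : 'I_(n_ineq S), 0 <= ineq_con j z)].

Definition smooth_near S z : Prop :=
  (forall i : 'I_(n_eq S), \forall y \near z, contdiff_at (eq_con i) y) /\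
  (forall j : 'I_(n_ineq S), \forall y \near z, contdiff_at (ineq_con j) y).

(* The vanishing gradient of the Lagrangian is tested against all directions. *)
Definition kkt F S z : Prop :=
  feasible S z /\
  exists (mu : 'I_(n_eq S) -> R) (nu : 'I_(n_ineq S) -> R),
    [/\ forall v, 'D_v F z + \sum_i mu i * 'D_v (eq_con i) z
                  - \sum_j nu j * 'D_v (ineq_con j) z = 0,
        forall j, 0 <= nu j
      & forall j, nu j * ineq_con j z = 0].

(* CQ is a condition on the constraints and a point (LICQ, MFCQ, ...), which
   turns local minimality for the objective F into the KKT conditions. *)
Definition is_constraint_qualification F
    (CQ : constraint_system -> V -> Prop) : Prop :=
  forall S z, smooth_near S z -> CQ S z ->
    local_minimizer F (feasible S) z -> kkt F S z.

End NonlinearProgram.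
Arguments constraint_system {R} V.

Section Bilevel.
Context {R : realType} {n r : nat}.
Implicit Types (w : 'rV[R]_n.+1) (lam : 'rV[R]_r.+1) (lbar : 'rV[R]_r).

Definition partial (i : 'I_n.+1) (h : 'rV[R]_n.+1 -> R) w : R :=
  'D_(delta_mx ord0 i) h w.

Definition zero_set w : {set 'I_n.+1} := [set j | w ord0 j == 0].

(* lambda has r.+1 entries; lambda_1 is lam ord0 ord0 and lambda-bar drops it. *)
Definition bar lam : 'rV[R]_r := col' ord0 lam.

Definition e1 : 'rV[R]_r.+1 := delta_mx ord0 ord0.

Definition Omega (eps : R) : set 'rV[R]_r.+1 :=
  [set lam | forall i, 0 <= (lam - eps *: e1) ord0 i].

Definition R1 (p : R) (psi : R -> R) w : R :=
  \sum_i psi (`|w ord0 i| `^ p).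

(* Rs i, for i : 'I_r, stands for R_{i+2}. *)
Definition G (g : 'rV[R]_n.+1 -> R) (Rs : 'I_r -> 'rV[R]_n.+1 -> R) w lbar : R :=
  g w + \sum_i lbar ord0 i * Rs i w.

Definition bilevel_feasible (eps p : R) psi g Rs :
    set ('rV[R]_n.+1 * 'rV[R]_r.+1) :=
  [set z | subdifferential
             (fun w => G g Rs w (bar z.2) + z.2 ord0 ord0 * R1 p psi w) z.1 0
           /\ Omega eps z.2].

(* The case p = 1, with the index set I kept fixed; psi1 is psi'. *)
Definition fixed_support_system (eps : R) (psi1 : R -> R) g Rs
    (I : {set 'I_n.+1}) : constraint_system ('rV[R]_n.+1 * 'rV[R]_r.+1)%type :=
  ConstraintSystem
    (fun (j : 'I_n.+1) (z : 'rV[R]_n.+1 * 'rV[R]_r.+1) =>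
       if j \in I then z.1 ord0 j
       else partial j (fun w => G g Rs w (bar z.2)) z.1
            + Num.sg (z.1 ord0 j) * z.2 ord0 ord0 * psi1 `|z.1 ord0 j|)
    (fun (i : 'I_r.+1) (z : 'rV[R]_n.+1 * 'rV[R]_r.+1) =>
       (z.2 - eps *: e1) ord0 i).

Section BKKT.
Variables (eps p : R) (psi1 psi2 : R -> R) (f g : 'rV[R]_n.+1 -> R)
  (Rs : 'I_r -> 'rV[R]_n.+1 -> R).

(* Entries of H-tilde, meant for i, j outside the zero set of w. *)
Definition bkkt_hessian w lam (i j : 'I_n.+1) : R :=
  let a := `|w ord0 i| in
  partial i (partial j (fun u => G g Rs u (bar lam))) w
  + (if i == j then
       lam ord0 ord0 * p * (p - 1) * a `^ (p - 2) * psi1 (a `^ p)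
       + lam ord0 ord0 * p ^+ 2 * a `^ (2 * p - 2) * psi2 (a `^ p)
     else 0).

Definition BKKT (z : 'rV[R]_n.+1 * 'rV[R]_r.+1) : Prop :=
  let w := z.1 in let lam := z.2 in let I := zero_set w in
  exists (zeta : 'rV[R]_n.+1) (eta : 'rV[R]_r.+1),
    (forall i, i \notin I ->
       partial i f w
       + \sum_(j | j \notin I) bkkt_hessian w lam i j * zeta ord0 j = 0) /\
    (forall i, i \notin I ->
       partial i (fun u => G g Rs u (bar lam)) w
       + p * lam ord0 ord0 * psi1 (`|w ord0 i| `^ p)
         * `|w ord0 i| `^ (p - 1) * Num.sg (w ord0 i) = 0) /\
    (forall i, i \in I -> zeta ord0 i = 0) /\
    p * (\sum_(i | i \notin I)
           psi1 (`|w ord0 i| `^ p) * `|w ord0 i| `^ (p - 1)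
           * Num.sg (w ord0 i) * zeta ord0 i) = eta ord0 ord0 /\
    (forall j : 'I_r,
       \sum_(i | i \notin I) partial i (Rs j) w * zeta ord0 i
       = bar eta ord0 j) /\
    (forall i, 0 <= (lam - eps *: e1) ord0 i) /\
    (forall i, 0 <= eta ord0 i) /\
    \sum_i (lam - eps *: e1) ord0 i * eta ord0 i = 0.

End BKKT.

End Bilevel.

(* Main.v *)
From HB Require Import structures.
From mathcomp Require Import ring lra.
Require Import Defs.

(* Let (w0, lambda0) be the given local optimum and I the zero set of w0. Near
   it the fixed-support system is a restriction of the bilevel constraint:
   coordinates outside I stay nonzero, so the penalty is smooth in them and the
   system says that the corresponding partial derivative of G + lambda_1 R_1
   vanishes; for j in I the strict bound on dG/dw_j persists, so the kink of
   lambda_1 psi(|w_j|) at w_j = 0 dominates the linear term and 0 is a regular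
   subgradient. Conversely (w0, lambda0) satisfies the system, since along a
   coordinate in which the function is smooth a regular subgradient has the
   partial derivative as its entry, and this passes to the limit. Hence
   (w0, lambda0) minimizes f locally under the system, the constraint
   qualification yields multipliers, and testing the Lagrangian along (e_i, 0)
   with i outside I and along (0, v) gives the BKKT conditions: zeta is the
   equality multiplier outside I and 0 on I, eta the inequality multiplier. *)

Set Implicit Arguments.
Unset Strict Implicit.
Unset Printing Implicit Defensive.

(** * Derivatives along lines and on the half-line; continuous differentiability near a point *)

Section Calculus.
Context {R : realType}.
Implicit Types V W : normedModType R.

(** By linearity of [phi] the two difference quotients are the same function of [t], so a single
    directional derivative of [h] is enough. *)
Lemma is_derive_comp_linear {V W} (phi : {linear V -> W}) (h : W -> R) x v d :
  is_derive (phi x) (phi v) h d -> is_derive x v (h \o phi) d.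
Proof.
have E : (fun t : R => t^-1 *: ((h \o phi \o shift x) (t *: v) - (h \o phi) x))
  = (fun t => t^-1 *: ((h \o shift (phi x)) (t *: phi v) - h (phi x))).
  by apply/funext => t /=; rewrite linearP.
by move=> [hd <-]; apply: DeriveDef; rewrite /derivable /derive E.
Qed.

(** On the line through [x] the restriction [phi] has one real variable, where derivable means
    differentiable, and its differential is linear. The rule thus also covers the penalty, which may
    have kinks in other coordinates. *)
Lemma is_derive_dirZ {V} (h : V -> R) x v (s d : R) :
  is_derive x v h d -> is_derive x (s *: v) h (s * d).
Proof.
pose phi (t : R) := h (t *: v + x).
have E c : (fun t : R => t^-1 *: ((h \o shift x) (t *: (c *: v)) - h x)) =
    (fun t => t^-1 *: ((phi \o shift 0) (t *: c) - phi 0)).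
  by apply/funext => t; rewrite /phi /= scale0r add0r addr0 scalerA.
move=> [hd <-].
have d1 : derivable phi 0 1.
  by rewrite /derivable -E scale1r.
have E1 : 'D_v h x = 'D_1 phi 0 by rewrite /derive -E scale1r.
have dphi : differentiable phi 0 by apply/derivable1_diffP.
apply: DeriveDef.
  by rewrite /derivable E; exact: diff_derivable.
rewrite E1 {1}/derive E -/('D_s phi 0) deriveE // deriv1E // derive1E.
done.
Qed.

Lemma differentiable_expansion {V} (h : V -> R) x (e : R) :
  differentiable h x -> 0 < e ->
  \forall y \near x, `|h y - h x - 'D_(y - x) h x| <= e * `|y - x|.
Proof.
move=> dh e0; rewrite (near_shift 0) subr0.
have /eqaddoP/(_ _ e0) := diff_locally dh.
apply: filterS => y /=; rewrite addrK deriveE // opprD addrA.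
done.
Qed.

(** Clearing the denominator makes the estimate true at [s = t] as well, so a full neighbourhood
    replaces the punctured one. *)
Lemma is_derivative_halflineP (u d : R -> R) (t e : R) :
  is_derivative_halfline u d -> 0 <= t -> 0 < e ->
  \forall s \near t, 0 <= s -> `|u s - u t - d t * (s - t)| <= e * `|s - t|.
Proof.
move=> hu t0 e0; have /cvgrPdist_le /(_ _ e0) := hu t t0.
rewrite near_withinE near_withinE => H; near=> s => s0.
have [->|st] := eqVneq s t; first by rewrite !subrr mulr0 subrr !normr0 mulr0.
have : `|d t - (u s - u t) / (s - t)| <= e.
  by apply: (near H s) => //=; rewrite in_itv/= s0.
have st0 : s - t != 0 by rewrite subr_eq0.
rewrite -(ler_pM2r (_ : 0 < `|s - t|)) ?normr_gt0 // -normrM mulrBl divfK //.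
by rewrite distrC.
Unshelve. all: by end_near. Qed.

Lemma is_derivative_halfline_is_derive (u d : R -> R) (t : R) :
  is_derivative_halfline u d -> 0 < t -> is_derive t 1 u (d t).
Proof.
move=> hu t0.
have C : h^-1 *: ((u \o shift t) (h *: (1 : R)) - u t) @[h --> 0^'] --> d t.
  apply/cvgrPdist_le => e e0; rewrite near_withinE.
  have H := is_derivative_halflineP hu (ltW t0) e0.
  (* Since [t > 0], the side condition [0 <= s] holds near [t]. *)
  have {}H : \forall s \near t, `|u s - u t - d t * (s - t)| <= e * `|s - t|.
    near=> s; apply: (near H s) => //; apply: ltW; near: s; exact: lt_nbhsr.
  move: H; rewrite (near_shift 0) subr0 /= => H.
  near=> h => /= h0; have : `|u (h + t) - u t - d t * (h + t - t)| <= e * `|h + t - t|.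
    by near: h.
  rewrite addrK.
  rewrite -[_%:A]/(h * 1) mulr1 => H1.
  by rewrite -(@ler_pM2r _ `|h|) ?normr_gt0 // -normrM mulrBl [h^-1 *: _]mulrC divfK // distrC.
by apply: DeriveDef; [apply/cvg_ex; exists (d t) | apply/cvg_lim].
Unshelve. all: by end_near. Qed.

(** Away from 0 the absolute value is locally the identity or the negation, and [|t|] is interior to
    the half-line. *)
Lemma is_derive_sg_comp_norm (u d : R -> R) (t : R) :
  is_derivative_halfline u d -> t != 0 ->
  is_derive t 1 (fun s => u `|s|) (Num.sg t * d `|t|).
Proof.
move=> hu; rewrite neq_lt => /orP[t0|t0].
  have H : is_derive (- t) 1 u (d (- t)).
    by apply: is_derivative_halfline_is_derive => //; rewrite oppr_gt0.
  apply: (@near_eq_is_derive _ _ _ (u \o -%R)).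
    near=> s => /=; rewrite ler0_norm //; near: s.
    by apply: filterS (lt_nbhsl t0) => s; exact: ltW.
  rewrite ltr0_sg // ltr0_norm // mulrC.
  exact: is_derive1_comp.
apply: (@near_eq_is_derive _ _ _ u).
  near=> s => /=; rewrite ger0_norm //; near: s.
  by apply: filterS (lt_nbhsr t0) => s; exact: ltW.
rewrite gtr0_sg // gtr0_norm // mul1r.
exact: is_derivative_halfline_is_derive.
Unshelve. all: by end_near. Qed.

(** Serves to replace ['D_v] of a compound function by the formula of the calculus rule, which is
    known only near [y]. *)
Lemma near_eq_continuous_at {T U : topologicalType} (F1 F2 : T -> U) y :
  (\forall x \near y, F1 x = F2 x) ->
  {for y, continuous F1} -> {for y, continuous F2}.
Proof.
move=> E; rewrite /prop_for /continuous_at -(nbhs_singleton E).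
by apply: cvg_trans; apply: near_eq_cvg; apply: filterS E => x ->.
Qed.

(* Differentiability at the single point z would not make contdiff_at stable
   under sums and products: the rules for 'D_v are needed at all points near z
   to compare the directional derivatives there. *)
Definition contdiff_near {V} (h : V -> R) (z : V) : Prop :=
  \forall y \near z, contdiff_at h y.

Lemma C1_contdiff_near {V} (h : V -> R) z : C1 h -> contdiff_near h z.
Proof. by move=> ch; apply: nearW. Qed.

Lemma contdiff_near_join {V} (h : V -> R) z :
  contdiff_near h z -> \forall y \near z, contdiff_near h y.
Proof. exact: near_join. Qed.


Lemma contdiff_near_cst {V} (c : R) (z : V) : contdiff_near (cst c) z.
Proof.
near=> y; split; first exact: differentiable_cst.
move=> v; rewrite (_ : (fun _ => _) = cst 0); first exact: cst_continuous.
by apply/funext => x; rewrite derive_cst.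
Unshelve. all: by end_near. Qed.

Lemma contdiff_nearD {V} (h k : V -> R) z :
  contdiff_near h z -> contdiff_near k z -> contdiff_near (h + k) z.
Proof.
move=> hz kz; near=> y.
have hy : contdiff_near h y by near: y; exact: contdiff_near_join.
have ky : contdiff_near k y by near: y; exact: contdiff_near_join.
have [[dh ch] [dk ck]] := (nbhs_singleton hy, nbhs_singleton ky).
split=> [|v]; first exact: differentiableD.
apply: (@near_eq_continuous_at _ _ (fun x => 'D_v h x + 'D_v k x)); last first.
  by apply: continuousD; [exact: ch | exact: ck].
near=> x; rewrite deriveD //; apply: diff_derivable.
  by have [] := near hy x.
by have [] := near ky x.
Unshelve. all: by end_near. Qed.

Lemma contdiff_nearM {V} (h k : V -> R) z :
  contdiff_near h z -> contdiff_near k z -> contdiff_near (h * k) z.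
Proof.
move=> hz kz; near=> y.
have hy : contdiff_near h y by near: y; exact: contdiff_near_join.
have ky : contdiff_near k y by near: y; exact: contdiff_near_join.
have [[dh ch] [dk ck]] := (nbhs_singleton hy, nbhs_singleton ky).
split=> [|v]; first exact: differentiableM.
apply: (@near_eq_continuous_at _ _ (fun x => h x * 'D_v k x + k x * 'D_v h x)).
  near=> x; rewrite deriveM //; apply: diff_derivable.
    by have [] := near hy x.
  by have [] := near ky x.
by apply: continuousD; apply: continuousM; 
  [exact: differentiable_continuous | exact: ck
  |exact: differentiable_continuous | exact: ch].
Unshelve. all: by end_near. Qed.

Lemma contdiff_near_sum {V} (I : finType) (h : I -> V -> R) z :
  (forall i, contdiff_near (h i) z) -> contdiff_near (\sum_i h i) z.
Proof.
move=> hz; elim/big_ind: _ => //; first exact: contdiff_near_cst.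
by move=> *; exact: contdiff_nearD.
Qed.

Lemma contdiff_near_comp_linear {V W} (phi : {linear V -> W}) (h : W -> R) z :
  continuous phi -> contdiff_near h (phi z) -> contdiff_near (h \o phi) z.
Proof.
move=> cphi hz; near=> y.
have hy : contdiff_near h (phi y).
  by near: y; apply: cphi; exact: contdiff_near_join.
have [dh ch] := nbhs_singleton hy.
split=> [|v]; first by apply: differentiable_comp => //; exact: linear_differentiable.
apply: (@near_eq_continuous_at _ _ (fun x => 'D_(phi v) h (phi x))).
  near=> x; apply/esym/derive_val; apply: is_derive_comp_linear.
  apply/derivableP/diff_derivable.
  have : contdiff_at h (phi x) by near: x; exact: (cphi y _ hy).
  by case.
apply: (@continuous_comp _ _ _ phi (fun w => 'D_(phi v) h w)); [exact: cphi | exact: ch].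
Unshelve. all: by end_near. Qed.

Lemma contdiff_near_linear {V} (phi : {linear V -> R}) z :
  continuous phi -> contdiff_near phi z.
Proof.
move=> cphi; near=> y; split; first exact: linear_differentiable.
move=> v; rewrite (_ : (fun _ => _) = cst (phi v)); first exact: cst_continuous.
apply/funext => x; rewrite deriveE ?diff_lin //; exact: linear_differentiable.
Unshelve. all: by end_near. Qed.


(** On the real line a direction is a scalar [v], and ['D_v u] is [v] times [d]. *)
Lemma contdiff_near_real (u d : R -> R) (t : R) :
  (\forall s \near t, is_derive (s : R) (1 : R) u (d s) /\ {for s, continuous d}) ->
  contdiff_near u t.
Proof.
move=> ud; apply: filterS (near_join ud) => s uds.
have [us ds] := nbhs_singleton uds.
split; first by apply/derivable1_diffP; exact: ex_derive.
move=> v; apply: (@near_eq_continuous_at _ _ (fun x => v *: d x)).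
  near=> x; have ux : is_derive x 1 u (d x) by near: x; apply: filterS uds => x [].
  
  rewrite deriveE; last by apply/derivable1_diffP; exact: ex_derive.
  rewrite deriv1E; last exact: ex_derive.
  by rewrite derive1E derive_val.
by apply: continuousM => //; exact: cst_continuous.
Unshelve. all: by end_near. Qed.

Lemma near_sg (t : R) : t != 0 -> \forall s \near t, Num.sg s = Num.sg t.
Proof.
rewrite neq_lt => /orP[t0|t0]; near=> s.
  by rewrite !ltr0_sg //; near: s; exact: lt_nbhsl.
by rewrite !gtr0_sg //; near: s; exact: lt_nbhsr.
Unshelve. all: by end_near. Qed.

(** The sign is locally constant, so it multiplies the derivative of [u |s|], and the two signs
    cancel because their square is 1. *)
Lemma is_derive_sgM_comp_norm (u d : R -> R) (t : R) :
  is_derivative_halfline u d -> t != 0 ->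
  is_derive t 1 (fun s => Num.sg s * u `|s|) (d `|t|).
Proof.
move=> hu t0; have H := is_derive_sg_comp_norm hu t0.
apply: (@near_eq_is_derive _ _ _ (Num.sg t \*: (fun s => u `|s|))).
  by near=> s; rewrite (near (near_sg t0) s).
have := @is_deriveZ _ _ _ _ (Num.sg t) _ _ _ H.
by rewrite [_ *: _]mulrA -expr2 sqr_sg t0 mul1r.
Unshelve. all: by end_near. Qed.

Lemma contdiff_near_sgM_comp_norm (u d : R -> R) (t : R) :
  is_derivative_halfline u d -> {within `[0, +oo[, continuous d} -> t != 0 ->
  contdiff_near (fun s : R => Num.sg s * u `|s|) t.
Proof.
move=> hu /subspace_continuousP cd t0; apply: (@contdiff_near_real _ (fun s => d `|s|)).
near=> s; have s0 : s != 0.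
  by rewrite -sgr_eq0 (near (near_sg t0) s) // sgr_eq0.
split; first exact: is_derive_sgM_comp_norm.
apply: continuous_comp; first exact: norm_continuous.
have s_gt0 : 0 < `|s| by rewrite normr_gt0.
(* One-sided continuity of [d] becomes ordinary continuity at [|s| > 0], since all nearby points lie
   in the half-line. *)
have /cvgrPdist_le ds : d @ within `[0, +oo[%classic (nbhs `|s|) --> d `|s|.
  by apply: cd => /=; rewrite in_itv/= ltW.
apply/cvgrPdist_le => e /ds; rewrite near_withinE => de.
near=> r; apply: (near de r) => //=; rewrite in_itv/= andbT ltW //.
by near: r; exact: lt_nbhsr.
Unshelve. all: by end_near. Qed.

End Calculus.

(** * Derivatives on products and on row vectors; regular subgradients against directional
    derivatives *)

Section RowVectors.
Context {R : realType}.

Lemma is_derive_cstM {V : normedModType R} (c : R) (h : V -> R) x v d :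
  is_derive x v h d -> is_derive x v (cst c * h) (c * d).
Proof.
move=> hd; have := is_deriveM (is_derive_cst c x v) hd.
by rewrite scaler0 addr0.
Qed.

Lemma is_derive_linear {V : normedModType R} (phi : {linear V -> R}) x v :
  is_derive x v phi (phi v).
Proof. exact: (@is_derive_comp_linear _ V R phi id x v _ (is_derive_id _ _)). Qed.

(** The difference quotients agree for every [t], so the identity holds whether or not the limits
    exist. *)
Lemma derive_fst {V W : normedModType R} (F : V * W -> R) z v :
  'D_(v, 0) F z = 'D_v (fun x => F (x, z.2)) z.1.
Proof.
rewrite /derive; set q1 := fun t : R => _; set q2 := fun t : R => _.
suff -> : q1 = q2 by [].
by apply/funext => t; case: z @q1 @q2 => a b /=; congr (_ *: (_ - _)); congr F;
  apply: injective_projections => /=; rewrite ?scaler0 ?add0r.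
Qed.

Lemma derive_snd {V W : normedModType R} (F : V * W -> R) z v :
  'D_(0, v) F z = 'D_v (fun x => F (z.1, x)) z.2.
Proof.
rewrite /derive; set q1 := fun t : R => _; set q2 := fun t : R => _.
suff -> : q1 = q2 by [].
by apply/funext => t; case: z @q1 @q2 => a b /=; congr (_ *: (_ - _)); congr F;
  apply: injective_projections => /=; rewrite ?scaler0 ?add0r.
Qed.

(** A named map, so that it can carry the linear structure that the composition rules ask for. *)
Definition coord {m : nat} (j : 'I_m) (w : 'rV[R]_m) : R := w ord0 j.

Fact coord_is_linear m (j : 'I_m) : linear (coord j).
Proof. by move=> a u v; rewrite /coord !mxE. Qed.

HB.instance Definition _ m (j : 'I_m) :=
  GRing.isLinear.Build R 'rV[R]_m R _ (coord j) (@coord_is_linear m j).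

Lemma continuous_coord m (j : 'I_m.+1) : continuous (coord j : 'rV[R]_m.+1 -> R).
Proof. exact: coord_continuous. Qed.

Lemma near_coord m (j : 'I_m.+1) (x : 'rV[R]_m.+1) (P : set R) :
  (\forall s \near x ord0 j, P s) -> \forall z \near x, P ((z : 'rV[R]_m.+1) ord0 j).
Proof. by move=> H; exact: (@continuous_coord _ j x _ H). Qed.

Lemma contdiff_coord m (j : 'I_m.+1) (z : 'rV[R]_m.+1) : contdiff_near (coord j) z.
Proof. by apply: contdiff_near_linear; exact: continuous_coord. Qed.

Lemma normr_coord_le m (j : 'I_m.+1) (w : 'rV[R]_m.+1) : `|w ord0 j| <= `|w|.
Proof.
rewrite -[leRHS]/(mx_norm w) mx_normrE.
exact: (le_bigmax _ (fun ij : 'I_1 * 'I_m.+1 => `|w ij.1 ij.2|) (ord0, j)).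
Qed.

Lemma dotprodZr n (v u : 'rV[R]_n.+1) t : dotprod v (t *: u) = t * dotprod v u.
Proof.
by rewrite /dotprod mulr_sumr; apply: eq_bigr => i _; rewrite mxE mulrCA.
Qed.

Lemma dotprod_delta n (v : 'rV[R]_n.+1) j : dotprod v (delta_mx ord0 j) = v ord0 j.
Proof.
rewrite /dotprod (bigD1 j) //= big1 => [|i ij]; first by rewrite mxE !eqxx mulr1 addr0.
by rewrite mxE (negbTE ij) andbF mulr0.
Qed.

Lemma derive_row_sum n (h : 'rV[R]_n.+1 -> R) x v :
  differentiable h x -> 'D_v h x = \sum_j v ord0 j * partial j h x.
Proof.
move=> dh; rewrite /partial deriveE // [v in LHS]row_sum_delta linear_sum.
by apply: eq_bigr => j _; rewrite linearZ deriveE.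
Qed.

(** The subgradient inequality at [x + t u], divided by [t > 0], bounds the difference quotient from
    below up to [e]; the limit from the right keeps this bound, and [e] is arbitrary. *)
Lemma regular_subgradient_derive n (h : 'rV[R]_n.+1 -> R) x v u :
  regular_subgradient h x v -> derivable h x u -> dotprod v u <= 'D_u h x.
Proof.
move=> hv hu; apply/ler_addgt0Pr => e e0.
(* With tolerance [e / (|u| + 1)] the error along [t u] is at most [t e], also when [u = 0]. *)
have u1 : 0 < `|u| + 1 by rewrite ltr_wpDl.
have := hv _ (divr_gt0 e0 u1).
rewrite (near_shift 0) subr0 => H.
rewrite -lerBlDr.
have cv : cvg (t^-1 *: ((h \o shift x) (t *: u) - h x) @[t --> 0^']) by exact: hu.
rewrite /derive cvg_at_rightE //; apply: limr_ge.
  by apply/cvg_ex; have /cvg_ex [l hl] := cv; exists l; exact: cvg_dnbhs_at_right hl.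
have cu : t *: u @[t --> 0^'+] --> (0 : 'rV[R]_n.+1).
  by apply: cvg_at_right_filter; rewrite -[X in _ --> X](scale0r u); exact: scalel_continuous.
near=> t.
have t0 : 0 < t by near: t; exact: nbhs_right_gt.
have : h x + dotprod v (t *: u + x - x) - e / (`|u| + 1) * `|t *: u + x - x| <= h (t *: u + x).
  by near: t; exact: (cu _ H).
rewrite addrK dotprodZr normrZ gtr0_norm // => ht.
have et : e / (`|u| + 1) * (t * `|u|) <= t * e.
  by rewrite mulrCA ler_pM2l // mulrAC ler_pdivrMr // ler_pM2l // lerDl.
rewrite -(ler_pM2l t0) -[_ *: _]/(_ * _) mulrA mulfV ?gt_eqF // mul1r /=.
lra.
Unshelve. all: by end_near. Qed.
End RowVectors.

(** * Smoothness of the constraint functions, and a first-order lower bound for the penalty in one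
    coordinate *)

Section PenalizedObjective.
Context {R : realType} {n r : nat}.
Variables (g : 'rV[R]_n.+1 -> R) (Rs : 'I_r -> 'rV[R]_n.+1 -> R).
Hypotheses (hg : C2 g) (hRs : forall i, C2 (Rs i)).
Variables psi psi1 psi2 : R -> R.
Hypotheses (hpsi1 : is_derivative_halfline psi psi1)
  (hpsi2 : is_derivative_halfline psi1 psi2)
  (hpsi2c : {within `[0, +oo[, continuous psi2}).

Local Notation X := 'rV[R]_n.+1.
Local Notation L := 'rV[R]_r.+1.

Lemma C2_differentiable (h : X -> R) x : C2 h -> differentiable h x.
Proof. move=> [h1 _]; exact: (proj1 (h1 x)). Qed.

Lemma C2_partial (h : X -> R) j x : C2 h -> contdiff_near (partial j h) x.
Proof. move=> [_ hj]; apply: C1_contdiff_near; exact: hj. Qed.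

Lemma G_funE (lb : 'rV[R]_r) :
  (fun w => G g Rs w lb) = g + \sum_i (cst (lb ord0 i) * Rs i).
Proof. by apply/funext => w; rewrite /G fctE fct_sumE. Qed.

Lemma differentiable_G lb x : differentiable (fun w => G g Rs w lb) x.
Proof.
rewrite G_funE; apply: differentiableD; first exact: C2_differentiable hg.
apply: differentiable_sum => i; apply: differentiableM; first exact: differentiable_cst.
exact: C2_differentiable (hRs i).
Qed.

Lemma partial_G j lb x : partial j (fun w => G g Rs w lb) x =
  partial j g x + \sum_i lb ord0 i * partial j (Rs i) x.
Proof.
have dh h : C2 h -> is_derive x (delta_mx ord0 j) h (partial j h x).
  by move=> hh; apply/derivableP/diff_derivable; exact: C2_differentiable hh.
rewrite G_funE; apply: derive_val; apply: is_deriveD; first exact: dh hg.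
by apply: is_derive_sum => i; apply: is_derive_cstM; exact: dh (hRs i).
Qed.

Lemma differentiable_partial_G j lb x :
  differentiable (partial j (fun w => G g Rs w lb)) x.
Proof.
have dp h : C2 h -> differentiable (partial j h) x.
  by move=> [_ /(_ (delta_mx ord0 j)) hj]; exact: (proj1 (hj x)).
have -> : partial j (fun w => G g Rs w lb) =
    partial j g + \sum_i (cst (lb ord0 i) * partial j (Rs i)).
  by apply/funext => y; rewrite partial_G -[RHS]/(_ + (\sum_i _) y) fct_sumE.
apply: differentiableD; first exact: dp hg.
apply: differentiable_sum => i; apply: differentiableM; first exact: differentiable_cst.
exact: dp (hRs i).
Qed.

(** Joint in [w] and [lam]: the partial derivative of [G] is affine in [lam], with coefficients that
    are C1 in [w]. *)
Lemma contdiff_partial_G j (z : X * L) :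
  contdiff_near (fun z : X * L => partial j (fun w => G g Rs w (bar z.2)) z.1) z.
Proof.
have -> : (fun z : X * L => partial j (fun w => G g Rs w (bar z.2)) z.1) =
  partial j g \o fst +
  \sum_i (coord (lift ord0 i) \o snd) * (partial j (Rs i) \o fst).
  apply/funext => y; rewrite partial_G -[RHS]/(_ + (\sum_i _) y) fct_sumE; congr (_ + _).
  by apply: eq_bigr => i _; rewrite !mxE.
have cf h : C2 h -> contdiff_near (partial j h \o fst) z.
  move=> hh; apply: contdiff_near_comp_linear; last exact: C2_partial hh.
  by move=> y; exact: cvg_fst.
apply: contdiff_nearD; first exact: cf hg.
apply: contdiff_near_sum => i; apply: contdiff_nearM; last exact: cf (hRs i).
apply: contdiff_near_comp_linear; first by move=> y; exact: cvg_snd.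
by apply: contdiff_near_linear; exact: continuous_coord.
Qed.

Lemma contdiff_penalty j (z : X * L) : z.1 ord0 j != 0 ->
  contdiff_near (fun z : X * L =>
    Num.sg (z.1 ord0 j) * z.2 ord0 ord0 * psi1 `|z.1 ord0 j|) z.
Proof.
move=> zj.
have -> : (fun z : X * L => Num.sg (z.1 ord0 j) * z.2 ord0 ord0 * psi1 `|z.1 ord0 j|) =
  (coord ord0 \o snd) * (((fun s : R => Num.sg s * psi1 `|s|) \o coord j) \o fst).
  by apply/funext => y; rewrite fctE /= /coord; ring.
apply: contdiff_nearM; apply: contdiff_near_comp_linear.
- by move=> y; exact: cvg_snd.
- by apply: contdiff_near_linear; exact: continuous_coord.
- by move=> y; exact: cvg_fst.
- apply: contdiff_near_comp_linear; first exact: continuous_coord.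
  exact: (contdiff_near_sgM_comp_norm hpsi2 hpsi2c zj).
Qed.

(** To first order [psi |s| - psi |t|] is [psi1 |t| * (|s| - |t|)]. At [t = 0] this slope dominates
    [c]; otherwise [c] cancels it, because [|s| - |t| >= sg t * (s - t)]. *)
Lemma penalty_subgradient (l c t e : R) : 0 <= l -> 0 < e ->
  (forall s, 0 <= s -> 0 < psi1 s) ->
  (t = 0 -> `|c| <= l * psi1 0) ->
  (t != 0 -> c + Num.sg t * l * psi1 `|t| = 0) ->
  \forall s \near t, - (e * `|s - t|) <= l * (psi `|s| - psi `|t|) + c * (s - t).
Proof.
move=> l0 e0 psi1_gt0 ct0 ct1.
(* The shift by 1 avoids a division by zero when [l = 0]. *)
have l1 : 0 < l + 1 by rewrite ltr_wpDl.
have /(_ _ (divr_gt0 e0 l1)) H := is_derivative_halflineP hpsi1 (normr_ge0 t).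
have {}H : \forall s \near t, `|psi `|s| - psi `|t| - psi1 `|t| * (`|s| - `|t|)|
    <= e / (l + 1) * `| `|s| - `|t| |.
  near=> s; have : 0 <= `|s| by [].
  by near: s; exact: (norm_continuous H).
near=> s; have : `|psi `|s| - psi `|t| - psi1 `|t| * (`|s| - `|t|)|
    <= e / (l + 1) * `| `|s| - `|t| | by near: s; exact: H.
have st := ler_dist_dist s t.
rewrite ler_norml => /andP[+ _].
have el : l * (e / (l + 1) * `| `|s| - `|t| |) <= e * `|s - t|.
  have le : l * (e / (l + 1)) <= e.
    by rewrite mulrA ler_pdivrMr // mulrC ler_pM2l // lerDl.
  rewrite mulrA; apply: ler_pM => //.
  by rewrite mulr_ge0 // divr_ge0 // ltW.
rewrite -subr_ge0 => /(mulr_ge0 l0) K.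
have p0 := psi1_gt0 _ (normr_ge0 t).
(* The remainder is already absorbed in [e * |s - t|]; only the linear parts remain to be
   compared. *)
have : - c * (s - t) <= l * (psi1 `|t| * (`|s| - `|t|)); last by lra.
have [t0|t0] := eqVneq t 0.
  move/(_ t0): ct0 => ct0; move: ct0; rewrite t0 => ct0.
  rewrite subr0 normr0 subr0 mulrA.
  apply: le_trans (ler_norm _) _; rewrite normrM normrN.
  by apply: ler_wpM2r.
have -> : - c = Num.sg t * l * psi1 `|t| by have := ct1 t0; lra.
have : Num.sg t * (s - t) <= `|s| - `|t|.
  rewrite mulrBr -normrEsg lerD2r; apply: le_trans (ler_norm _) _.
  by rewrite normrM normr_sg t0 mul1r.
move=> /(ler_wpM2l (mulr_ge0 l0 (ltW p0))); lra.
Unshelve. all: by end_near. Qed.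
End PenalizedObjective.

(** * Coordinatewise stationarity against zero subgradients of the penalized objective *)

Section FirstOrderConditions.
Context {R : realType} {n r : nat}.
Variables (g : 'rV[R]_n.+1 -> R) (Rs : 'I_r -> 'rV[R]_n.+1 -> R).
Hypotheses (hg : C2 g) (hRs : forall i, C2 (Rs i)).
Variables psi psi1 psi2 : R -> R.
Hypotheses (hpsi1 : is_derivative_halfline psi psi1)
  (hpsi2 : is_derivative_halfline psi1 psi2)
  (hpsi2c : {within `[0, +oo[, continuous psi2})
  (psi1_gt0 : forall s, 0 <= s -> 0 < psi1 s).
Implicit Types (x y w : 'rV[R]_n.+1) (lam : 'rV[R]_r.+1).

(** [G] is replaced by its linearization, whose coordinates pair with the separable penalty, so that
    the one-variable bound can be summed. *)
Lemma regular_subgradient0 x lam : 0 <= lam ord0 ord0 ->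
  (forall j, x ord0 j = 0 ->
     `|partial j (fun w => G g Rs w (bar lam)) x| <= lam ord0 ord0 * psi1 0) ->
  (forall j, x ord0 j != 0 ->
     partial j (fun w => G g Rs w (bar lam)) x
       + Num.sg (x ord0 j) * lam ord0 ord0 * psi1 `|x ord0 j| = 0) ->
  regular_subgradient
    (fun w => G g Rs w (bar lam) + lam ord0 ord0 * R1 1 psi w) x 0.
Proof.
move=> l0 hx0 hx1 e e0; set h := fun w => G g Rs w (bar lam).
(* Half of [e] pays for the expansion of [G], the other half is shared equally by the [n.+1]
   coordinates. *)
have e2 : 0 < e / 2 by rewrite divr_gt0.
have en : 0 < e / 2 / n.+1%:R by rewrite divr_gt0.
have HG := differentiable_expansion (differentiable_G hg hRs (bar lam) x) e2.
have HP : nbhs x (fun y : 'rV[R]_n.+1 => forall j,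
    - (e / 2 / n.+1%:R * `|y ord0 j - x ord0 j|) <=
    lam ord0 ord0 * (psi `|y ord0 j| - psi `|x ord0 j|)
    + partial j h x * (y ord0 j - x ord0 j)).
  apply: (filter_forall (nbhs_filter x)) => j;
  exact: (near_coord (penalty_subgradient hpsi1 l0 en psi1_gt0 (hx0 j) (hx1 j))).
apply: filterS2 HG HP => y.
rewrite ler_norml => /andP[Gy _] Py.
have dot0 : dotprod 0 (y - x) = 0.
  by rewrite /dotprod big1 // => i _; rewrite mxE mul0r.
have P1 : - (e / 2 * `|y - x|) <= lam ord0 ord0 * (R1 1 psi y - R1 1 psi x) + 'D_(y - x) h x.
  rewrite derive_row_sum; last exact: differentiable_G.
  rewrite /R1 -sumrB mulr_sumr -big_split /=.
  have -> : - (e / 2 * `|y - x|) = \sum_(i < n.+1) - (e / 2 / n.+1%:R * `|y - x|).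
    rewrite sumr_const card_ord mulNrn; congr (- _).
    by rewrite -[RHS]mulr_natr [RHS]mulrAC divfK ?pnatr_eq0.
  apply: ler_sum => i _; rewrite !powRr1 // !mxE [_ * partial _ _ _]mulrC.
  apply: le_trans (Py i); rewrite lerN2 ler_pM2l //.
  by have := normr_coord_le i (y - x); rewrite !mxE.
rewrite dot0; move: Gy P1; rewrite -/h /=; lra.
Qed.

Lemma is_derive_R1 x j : x ord0 j != 0 ->
  is_derive x (delta_mx ord0 j) (R1 1 psi) (Num.sg (x ord0 j) * psi1 `|x ord0 j|).
Proof.
move=> xj.
have -> : (R1 1 psi : 'rV[R]_n.+1 -> R) =
    \sum_i ((fun s : R => psi `|s|) \o coord i).
  by apply/funext => w; rewrite fct_sumE; apply: eq_bigr => i _; rewrite powRr1.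
have -> : Num.sg (x ord0 j) * psi1 `|x ord0 j| =
    \sum_i (if i == j then Num.sg (x ord0 j) * psi1 `|x ord0 j| else 0).
  by rewrite -big_mkcond big_pred1_eq.
apply: is_derive_sum => i; apply: is_derive_comp_linear.
have [->|ij] := eqVneq i j; rewrite /= /coord mxE eqxx.
  by rewrite eqxx; exact: is_derive_sg_comp_norm.
(* The direction has zero entry at [i], and any function has derivative 0 along 0; a kink in this
   summand is harmless. *)
by rewrite (negbTE ij); exact: is_derive0.
Qed.

(** Near [x] coordinate [j] stays nonzero, so entry [j] of every regular subgradient is the partial
    derivative [F]; continuity of [F] at [x] passes this to the limit. *)
Lemma subdifferential_stationary x lam j :
  subdifferential
    (fun w => G g Rs w (bar lam) + lam ord0 ord0 * R1 1 psi w) x 0 ->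
  x ord0 j != 0 ->
  partial j (fun w => G g Rs w (bar lam)) x
    + Num.sg (x ord0 j) * lam ord0 ord0 * psi1 `|x ord0 j| = 0.
Proof.
move=> [xs [vs [cx cv hv]]] xj.
pose F w := partial j (fun w => G g Rs w (bar lam)) w
    + Num.sg (w ord0 j) * lam ord0 ord0 * psi1 `|w ord0 j|.
(* [F] is a slice, with [lam] fixed, of a function differentiable in both variables. *)
have cF : {for x, continuous F}.
  have D1 := nbhs_singleton (contdiff_partial_G hg hRs j (x, lam)).
  have D2 := nbhs_singleton (contdiff_penalty hpsi2 hpsi2c (z := (x, lam)) xj).
  have C := continuousD (differentiable_continuous (proj1 D1))
    (differentiable_continuous (proj1 D2)).
  have P : {for x, continuous (fun w => (w, lam))}.
    by apply: (@cvg_pair _ _ _ (nbhs x) (nbhs x) (nbhs lam)); [exact: cvg_id | exact: cvg_cst].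
  exact: (continuous_comp P C).
have dF w : w ord0 j != 0 -> forall v, regular_subgradient
    (fun w => G g Rs w (bar lam) + lam ord0 ord0 * R1 1 psi w) w v -> v ord0 j = F w.
  move=> wj v hw.
  (* The directions with [s = 1] and [s = -1] give the two inequalities that make an equality. *)
  have H s : is_derive w (s *: delta_mx ord0 j)
      (fun w => G g Rs w (bar lam) + lam ord0 ord0 * R1 1 psi w) (s * F w).
    apply: is_derive_dirZ; apply: is_deriveD.
      by apply/derivableP/diff_derivable; exact: differentiable_G.
    rewrite -mulrA mulrCA; apply: is_derive_cstM; exact: is_derive_R1.
  apply/eqP; rewrite eq_le; apply/andP; split.
    have H1 := H 1.
    have := regular_subgradient_derive hw (@ex_derive _ _ _ _ _ _ _ H1).
    by rewrite derive_val scale1r mul1r dotprod_delta.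
  have H1 := H (-1).
  have := regular_subgradient_derive hw (@ex_derive _ _ _ _ _ _ _ H1).
  by rewrite derive_val dotprodZr !mulN1r lerN2 dotprod_delta.
have nz : \forall k \near \oo, vs k ord0 j = F (xs k).
  have N : \forall s \near x ord0 j, s != 0.
    by apply: filterS (near_sg xj) => s sj; rewrite -sgr_eq0 sj sgr_eq0.
  have K : \forall k \near \oo, xs k ord0 j != 0 by exact: (cx _ (near_coord N)).
  by apply: filterS K => k kj; exact: dF kj _ (hv k).
have c1 : vs k ord0 j @[k --> \oo] --> (0 : R).
  have E : coord j (0 : 'rV[R]_n.+1) = 0 by rewrite /coord mxE.
  by rewrite -[X in _ --> X]E; exact: (cvg_comp _ _ cv (@continuous_coord _ _ j 0)).
have c2 : vs k ord0 j @[k --> \oo] --> F x.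
  apply: cvg_trans (cvg_comp _ _ cx cF); apply: near_eq_cvg.
  by apply: filterS nz => k ->.
exact: (cvg_unique _ c2 c1).
Qed.
End FirstOrderConditions.

(** * Local comparison of the fixed-support system with the bilevel constraint *)

Section FixedSupport.
Context {R : realType} {n r : nat}.
Variables (g : 'rV[R]_n.+1 -> R) (Rs : 'I_r -> 'rV[R]_n.+1 -> R).
Hypotheses (hg : C2 g) (hRs : forall i, C2 (Rs i)).
Variables psi psi1 psi2 : R -> R.
Hypotheses (hpsi1 : is_derivative_halfline psi psi1)
  (hpsi2 : is_derivative_halfline psi1 psi2)
  (hpsi2c : {within `[0, +oo[, continuous psi2})
  (psi1_gt0 : forall s, 0 <= s -> 0 < psi1 s).
Variable eps : R.
Variables (ws : 'rV[R]_n.+1) (lams : 'rV[R]_r.+1).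
Local Notation S := (fixed_support_system eps psi1 g Rs (zero_set ws)).

(** Constraints indexed by the zero set are linear; the others stay away from the jump of the sign,
    since [ws] is nonzero there. *)
Lemma fixed_support_smooth_near : smooth_near S (ws, lams).
Proof.
split=> [j|i] /=; last first.
  rewrite -/(contdiff_near _ _).
  have -> : (fun z : 'rV[R]_n.+1 * 'rV[R]_r.+1 => (z.2 - eps *: e1) ord0 i) =
      (coord i \o snd) + cst (- (eps *: (e1 : 'rV[R]_r.+1)) ord0 i).
    by apply/funext => z; rewrite !mxE.
  apply: contdiff_nearD; last exact: contdiff_near_cst.
  apply: contdiff_near_comp_linear; first by move=> y; exact: cvg_snd.
  exact: contdiff_coord.
rewrite -/(contdiff_near _ _); have [jI|jI] := boolP (j \in zero_set ws).
  apply: (@contdiff_near_comp_linear _ _ _ fst (coord j)); first by move=> y; exact: cvg_fst.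
  exact: contdiff_coord.
apply: contdiff_nearD; first exact: contdiff_partial_G.
by apply: (contdiff_penalty hpsi2 hpsi2c); move: jI; rewrite inE.
Qed.

Hypothesis eps_gt0 : 0 < eps.

Lemma Omega_lam1_gt0 lam : Omega eps lam -> 0 < (lam : 'rV[R]_r.+1) ord0 ord0.
Proof. by move=> /(_ ord0); rewrite !mxE !eqxx mulr1 subr_ge0; exact: lt_le_trans. Qed.

Lemma bilevel_feasible_fixed_support :
  bilevel_feasible eps 1 psi g Rs (ws, lams) -> feasible S (ws, lams).
Proof.
move=> [sub Om]; split=> [j|i] /=; last exact: Om.
case: ifPn; rewrite inE; [by move/eqP | move=> wj].
exact: (subdifferential_stationary hg hRs hpsi1 hpsi2 hpsi2c sub wj).
Qed.

Hypothesis hmax : forall i, i \in zero_set ws ->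
  `|partial i (fun w => G g Rs w (bar lams)) ws| < lams ord0 ord0 * psi1 0.

(** Near the point, a feasible [w] has exactly the zero set of [ws], and the strict bound at its
    zeros persists by continuity, so both cases of [regular_subgradient0] apply. *)
Lemma near_fixed_support_bilevel_feasible :
  \forall z \near (ws, lams), feasible S z -> bilevel_feasible eps 1 psi g Rs z.
Proof.
pose D j (z : 'rV[R]_n.+1 * 'rV[R]_r.+1) :=
  z.2 ord0 ord0 * psi1 0 - `|partial j (fun w => G g Rs w (bar z.2)) z.1|.
have near1 j : nbhs (ws, lams) (fun z => j \in zero_set ws -> 0 < D j z).
  have [jI|jI] := boolP (j \in zero_set ws); last exact: filterE.
  have cD : {for (ws, lams), continuous (D j)}.
    have cl : {for (ws, lams),
        continuous (fun z : 'rV[R]_n.+1 * 'rV[R]_r.+1 => z.2 ord0 ord0)}.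
      apply: (continuous_comp (f := snd) (g := coord ord0)); first exact: cvg_snd.
      exact: continuous_coord.
    have cp : {for (ws, lams), continuous
        (fun z : 'rV[R]_n.+1 * 'rV[R]_r.+1 => partial j (fun w => G g Rs w (bar z.2)) z.1)}.
      apply: differentiable_continuous.
      exact: (proj1 (nbhs_singleton (contdiff_partial_G hg hRs j (ws, lams)))).
    apply: continuousB; first by apply: continuousM => //; exact: cst_continuous.
    by apply: (continuous_comp cp); exact: norm_continuous.
  have D0 : 0 < D j (ws, lams) by rewrite subr_gt0; exact: hmax.
  have K : nbhs (ws, lams) (fun z => 0 < D j z) by exact: (cD _ (lt_nbhsr D0)).
  by apply: filterS K => z.
have near2 j : nbhs (ws, lams) (fun z => j \notin zero_set ws -> z.1 ord0 j != 0).
  have [jI|] := boolP (j \in zero_set ws); first exact: filterE.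
  rewrite inE => wj.
  have N : \forall s \near ws ord0 j, s != 0.
    by apply: filterS (near_sg wj) => s sj; rewrite -sgr_eq0 sj sgr_eq0.
  have K : nbhs (ws, lams) (fun z : 'rV[R]_n.+1 * 'rV[R]_r.+1 => z.1 ord0 j != 0).
    by exact: (cvg_fst (near_coord N)).
  by apply: filterS K => z.
have H1 := filter_forall (nbhs_filter (ws, lams)) near1.
have H2 := filter_forall (nbhs_filter (ws, lams)) near2.
apply: filterS2 H1 H2 => -[w lam] /= z1 z2 [Seq Sin]; split=> //=.
(* Constant sequences suffice, as 0 is a regular subgradient at [w] itself. *)
exists (fun=> w), (fun=> 0); split; [exact: cvg_cst | exact: cvg_cst | move=> _].
have eqj j : j \notin zero_set ws -> partial j (fun w => G g Rs w (bar lam)) w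
    + Num.sg (w ord0 j) * lam ord0 ord0 * psi1 `|w ord0 j| = 0.
  by move=> /negbTE jI; have := Seq j; rewrite /= jI.
have l0 : 0 < lam ord0 ord0 by exact: Omega_lam1_gt0 Sin.
apply: (regular_subgradient0 hg hRs hpsi1 psi1_gt0 (ltW l0)) => j wj.
  have [jI|jI] := boolP (j \in zero_set ws); last by have := z2 j jI; rewrite wj eqxx.
  by have := z1 j jI; rewrite subr_gt0 => /ltW.
(* A nonzero coordinate lies outside the index set, because the system annihilates those inside. *)
apply: eqj; apply/negP => jI; have := Seq j; rewrite /= jI => wj0.
by rewrite wj0 eqxx in wj.
Qed.
End FixedSupport.

(** * Derivatives of the constraints, and the passage from Lagrange multipliers to BKKT *)

Section Multipliers.
Context {R : realType} {n r : nat}.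
Variables (g : 'rV[R]_n.+1 -> R) (Rs : 'I_r -> 'rV[R]_n.+1 -> R).
Hypotheses (hg : C2 g) (hRs : forall i, C2 (Rs i)).
Variables psi1 psi2 : R -> R.
Hypothesis hpsi2 : is_derivative_halfline psi1 psi2.
Variable eps : R.
Variables (ws : 'rV[R]_n.+1) (lams : 'rV[R]_r.+1).
Local Notation S := (fixed_support_system eps psi1 g Rs (zero_set ws)).

(** Inside the zero set [j] differs from [i], so coordinate [j] is constant along the direction.
    Outside, the diagonal term arises by differentiating [sg s * psi1 |s|]. *)
Lemma derive_eq_con_primal i (j : 'I_n.+1) : i \notin zero_set ws ->
  'D_(delta_mx ord0 i, 0) (@eq_con _ _ S j) (ws, lams) =
  if j \in zero_set ws then 0 else bkkt_hessian 1 psi1 psi2 g Rs ws lams i j.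
Proof.
move=> iI; rewrite derive_fst /=; case: ifPn => jI.
  have -> : 'D_(delta_mx ord0 i) (fun x : 'rV[R]_n.+1 => x ord0 j) ws =
      coord j (delta_mx ord0 i).
    by apply: derive_val; exact: (is_derive_linear (coord j)).
  rewrite /coord mxE eqxx; case: eqP => // ji; by rewrite -ji jI in iI.
(* At [p = 1] the factor [p - 1] kills the first diagonal term, and the power in the second has
   exponent 0. *)
rewrite /bkkt_hessian /= !powRr1 // expr1n !mulr1 !subrr powRr0 mulr0 !mul0r add0r mulr1.
have -> : (fun x : 'rV[R]_n.+1 => partial j (fun w => G g Rs w (bar lams)) x
    + Num.sg (x ord0 j) * lams ord0 ord0 * psi1 `|x ord0 j|) =
   (partial j (fun w => G g Rs w (bar lams))) +
   cst (lams ord0 ord0) * ((fun s : R => Num.sg s * psi1 `|s|) \o coord j).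
  by apply/funext => x; rewrite -[RHS]/(_ + _ * (_ * _)) /= /coord; ring.
apply: derive_val; apply: is_deriveD.
  by apply/derivableP/diff_derivable; exact: differentiable_partial_G.
have -> : (if i == j then lams ord0 ord0 * psi2 `|ws ord0 i| else 0) =
  lams ord0 ord0 * (if i == j then psi2 `|ws ord0 i| else 0) by case: ifP; rewrite ?mulr0.
apply: is_derive_cstM; apply: is_derive_comp_linear.
rewrite /= /coord mxE eqxx /= [j == i]eq_sym.
have [<-|ij] := eqVneq i j; last exact: is_derive0.
by apply: is_derive_sgM_comp_norm; move: iI; rewrite inE.
Qed.

(** For fixed [w] each constraint is affine in [lam]; its derivative is the linear part at [v]. *)
Lemma derive_eq_con_dual (v : 'rV[R]_r.+1) (j : 'I_n.+1) :
  'D_(0, v) (@eq_con _ _ S j) (ws, lams) =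
  if j \in zero_set ws then 0 else
    \sum_i v ord0 (lift ord0 i) * partial j (Rs i) ws
    + Num.sg (ws ord0 j) * v ord0 ord0 * psi1 `|ws ord0 j|.
Proof.
rewrite derive_snd /=; case: ifPn => jI; first exact: derive_cst.
have -> : (fun x : 'rV[R]_r.+1 => partial j (fun w => G g Rs w (bar x)) ws
    + Num.sg (ws ord0 j) * x ord0 ord0 * psi1 `|ws ord0 j|) =
   cst (partial j g ws) + (\sum_i cst (partial j (Rs i) ws) * coord (lift ord0 i)
     + cst (Num.sg (ws ord0 j) * psi1 `|ws ord0 j|) * coord ord0).
  apply/funext => x; rewrite partial_G // -[RHS]/(_ + ((\sum_i _) x + _ * _)).
  rewrite fct_sumE /= addrA.
  congr (_ + _ + _); last by rewrite /coord; ring.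
  by apply: eq_bigr => i _; rewrite mulrC !mxE.
have D1 : is_derive lams v (\sum_i cst (partial j (Rs i) ws) * coord (lift ord0 i))
    (\sum_i partial j (Rs i) ws * coord (lift ord0 i) v).
  by apply: is_derive_sum => i; exact: is_derive_cstM (is_derive_linear _ _ _).
have D2 : is_derive lams v (cst (Num.sg (ws ord0 j) * psi1 `|ws ord0 j|) * coord ord0)
    (Num.sg (ws ord0 j) * psi1 `|ws ord0 j| * coord ord0 v).
  exact: is_derive_cstM (is_derive_linear _ _ _).
have D3 := is_deriveD (is_derive_cst (partial j g ws) lams v) (is_deriveD D1 D2).
rewrite (@derive_val _ _ _ _ _ _ _ D3) add0r mulrAC; congr (_ + _).
by apply: eq_bigr => i _; rewrite mulrC.
Qed.

Lemma derive_ineq_con (u : 'rV[R]_n.+1) (v : 'rV[R]_r.+1) (i : 'I_r.+1) :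
  'D_(u, v) (@ineq_con _ _ S i) (ws, lams) = v ord0 i.
Proof.
have -> : @ineq_con _ _ S i =
    ((coord i \o snd) + cst (- (eps *: (e1 : 'rV[R]_r.+1)) ord0 i)
      : 'rV[R]_n.+1 * 'rV[R]_r.+1 -> R).
  by apply/funext => z; rewrite /= !mxE.
have D1 : is_derive (ws, lams) (u, v) (coord i \o snd) (v ord0 i).
  exact: (is_derive_comp_linear (phi := snd) (is_derive_linear (coord i) _ _)).
have D2 := is_deriveD D1
  (is_derive_cst (- (eps *: (e1 : 'rV[R]_r.+1)) ord0 i) (ws, lams) (u, v)).
by rewrite (@derive_val _ _ _ _ _ _ _ D2) addr0.
Qed.

Lemma kkt_BKKT (f : 'rV[R]_n.+1 -> R) :
  kkt (fun z : 'rV[R]_n.+1 * 'rV[R]_r.+1 => f z.1) S (ws, lams) ->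
  BKKT eps 1 psi1 psi2 f g Rs (ws, lams).
Proof.
move=> [[Seq Sin] [mu [nu [gradL nu_ge0 slack]]]]; rewrite /BKKT /=.
(* The discarded multipliers belong to the constraints [w_j = 0], whose derivatives vanish in every
   direction tested below. *)
pose zeta : 'rV[R]_n.+1 := \row_j (if j \in zero_set ws then 0 else mu j).
have sumE (c : 'I_n.+1 -> R) :
    \sum_(j < n.+1) mu j * (if j \in zero_set ws then 0 else c j) =
    \sum_(j | j \notin zero_set ws) c j * zeta ord0 j.
  rewrite [RHS]big_mkcond; apply: eq_bigr => j _.
  by rewrite mxE; case: ifP => _; rewrite ?mulr0 // mulrC.
(* Stationarity along [(0, v)], where the objective is constant; basis vectors [v] will isolate the
   single [nu k]. *)
have dual (v : 'rV[R]_r.+1) : \sum_(j | j \notin zero_set ws)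
    (\sum_i v ord0 (lift ord0 i) * partial j (Rs i) ws
    + Num.sg (ws ord0 j) * v ord0 ord0 * psi1 `|ws ord0 j|) * zeta ord0 j =
    \sum_i nu i * v ord0 i.
  have f0 : 'D_(0, v) (fun z : 'rV[R]_n.+1 * 'rV[R]_r.+1 => f z.1) (ws, lams) = 0.
    by rewrite derive_snd; exact: (derive_cst (f ws) lams v).
  have := gradL (0, v); rewrite f0 add0r => /subr0_eq.
  under eq_bigr do rewrite derive_eq_con_dual.
  under [in RHS]eq_bigr do rewrite derive_ineq_con.
  by rewrite sumE.
have dual_delta (k : 'I_r.+1) : \sum_i nu i * (delta_mx ord0 k : 'rV[R]_r.+1) ord0 i = nu k.
  rewrite (bigD1 k) //= mxE !eqxx mulr1 big1 ?addr0 // => i ik.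
  by rewrite mxE (negbTE ik) andbF mulr0.
exists zeta, (\row_i nu i).
split; [|split; [|split; [|split; [|split; [|split; [|split]]]]]].
- move=> i iI; have := gradL (delta_mx ord0 i, 0).
  (* The inequality constraints do not depend on [w]. *)
  rewrite [X in _ - X]big1 ?subr0 => [|k _]; last by rewrite derive_ineq_con mxE mulr0.
  rewrite derive_fst -sumE => L; rewrite -[RHS]L; congr (_ + _); apply: eq_bigr => j _.
  by rewrite derive_eq_con_primal.
- move=> i iI; have := Seq i; rewrite /= (negbTE iI) => L; rewrite -[RHS]L.
  by rewrite powRr1 // subrr powRr0; congr (_ + _); ring.
- by move=> i iI; rewrite mxE iI.
(* Taking [v] to be the first basis vector leaves only the penalty term. *)
- rewrite mxE -dual_delta -dual mul1r; apply: eq_bigr => j _; congr (_ * _).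
  rewrite powRr1 // subrr powRr0 big1 => [|k _]; last by rewrite mxE andbF mul0r.
  by rewrite mxE !eqxx /=; ring.
(* With [v] the basis vector at [lift ord0 k] the penalty term vanishes and only [Rs k]
   contributes. *)
- move=> k; rewrite !mxE -dual_delta -dual; apply: eq_bigr => j _; congr (_ * _).
  rewrite (bigD1 k) //= big1 => [|l lk].
    by rewrite !mxE !eqxx /=; ring.
  by rewrite mxE (inj_eq lift_inj) (negbTE lk) andbF mul0r.
- exact: Sin.
- by move=> i; rewrite mxE.
- by apply: big1 => i _; rewrite mulrC [X in X * _]mxE; exact: slack.
Qed.
End Multipliers.

Theorem proposition3p4 (R : realType) (n r : nat)
  (f g : 'rV[R]_n.+1 -> R) (Rs : 'I_r -> 'rV[R]_n.+1 -> R)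
  (psi psi1 psi2 : R -> R) (alpha beta eps : R)
  (hf : C1 f) (hg : C2 g) (hRs : forall i, C2 (Rs i))
  (heps : 0 < eps) (halpha : 0 < alpha) (hbeta : 0 < beta)
  (hpsi1 : is_derivative_halfline psi psi1)
  (hpsi2 : is_derivative_halfline psi1 psi2)
  (hpsi2c : {within `[0, +oo[, continuous psi2})
  (hpsi1b : forall t, 0 <= t -> 0 < psi1 t <= alpha)
  (hpsi2b : forall t, 0 <= t -> - beta <= psi2 t <= 0)
  (ws : 'rV[R]_n.+1) (lams : 'rV[R]_r.+1)
  (hopt : local_minimizer (fun z : 'rV[R]_n.+1 * 'rV[R]_r.+1 => f z.1)
            (bilevel_feasible eps 1 psi g Rs) (ws, lams))
  (hmax : forall i, i \in zero_set ws ->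
     `|partial i (fun w => G g Rs w (bar lams)) ws| < lams ord0 ord0 * psi1 0)
  (CQ : constraint_system ('rV[R]_n.+1 * 'rV[R]_r.+1)%type ->
        'rV[R]_n.+1 * 'rV[R]_r.+1 -> Prop)
  (hCQ : is_constraint_qualification
           (fun z : 'rV[R]_n.+1 * 'rV[R]_r.+1 => f z.1) CQ)
  (hCQs : CQ (fixed_support_system eps psi1 g Rs (zero_set ws)) (ws, lams)) :
  BKKT eps 1 psi1 psi2 f g Rs (ws, lams).
Proof.
have psi1_gt0 s : 0 <= s -> 0 < psi1 s by move=> /hpsi1b /andP[].
have [feas fmin] := hopt.
apply: (kkt_BKKT hg hRs hpsi2); apply: hCQ => //.
  exact: (fixed_support_smooth_near hg hRs hpsi2 hpsi2c).
split; first exact: (bilevel_feasible_fixed_support hg hRs hpsi1 hpsi2 hpsi2c).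
have H := near_fixed_support_bilevel_feasible hg hRs hpsi1 psi1_gt0 heps hmax.
(* Minimality is inherited by the locally smaller feasible set. *)
by apply: filterS2 fmin H => z zmin zS /zS; exact: zmin.
Qed.
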